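(* Bounded variable elimination applied to a non-concrete feature is sampling-safe. That is, let $\varphi$ be a CNF formula with concrete feature set $\mathcal{C}$, let $y\notin\mathcal{C}$ be a feature, and let $\psi$ be obtained from $\varphi$ by eliminating $y$ (adding all non-tautological resolvents on $y$ of a clause containing $y$ with a clause containing $\overline{y}$, then deleting all clauses containing $y$ or $\overline{y}$ and the variable $y$), with the same concrete feature set $\mathcal{C}$. Then for every sample of $\varphi$ with pairwise coverage there is a sample of $\psi$ with pairwise coverage of the same size, and for every sample of $\psi$ with pairwise coverage there is a sample of $\varphi$ with pairwise coverage of the same size.
   Context: A CNF formula $\varphi$ over Boolean features $\mathcal{F}$ with concrete features $\mathcal{C}\subseteq\mathcal{F}$. Configurations are satisfying assignments, viewed as sets of literals. A pairwise interaction is a set of 2 literals of concrete features; it is feasible if contained in some satisfying assignment. A sample (set of satisfying assignments) has pairwise coverage if every feasible pairwise interaction is contained in some member; additionally, by convention, if the formula is satisfiable the sample must contain at least one configuration, and if there is exactly one concrete feature $x$ and both $x$ and $\overline{x}$ occur in satisfying assignments, the sample must contain a configuration with $x$ and one with $\overline{x}$.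
   Formalization: Samples are finite sequences with size counted with repetitions, since for sets the claim from φ to ψ fails (no clauses, F={x,y}, C={x}: a sample of size 4 but ψ has 2 configurations); from ψ to φ a repetition-free sample yields a repetition-free one. *)

(* Defs.v *)
From mathcomp Require Import all_boot.

Set Implicit Arguments.
Unset Strict Implicit.
Unset Printing Implicit Defensive.

(* Features are taken from an ambient finite type V of names.
   The literal x is (x, true) and its negation is (x, false). *)
Definition literal (V : finType) : finType := (V * bool)%type.

Record cnf (V : finType) := Cnf {
  features : {set V};
  clauses : {set {set literal V}}
}.

Definition wf_cnf (V : finType) (phi : cnf V) : Prop :=
  forall (c : {set literal V}) (l : literal V),
    c \in clauses phi -> l \in c -> l.1 \in features phi.

Definition assignment (V : finType) (F : {set V}) (a : {set literal V}) : Prop :=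
  (forall l, l \in a -> l.1 \in F) /\
  (forall x, x \in F -> ((x, true) \in a) = ((x, false) \notin a)).

Definition configuration (V : finType) (phi : cnf V) (a : {set literal V}) : Prop :=
  assignment (features phi) a /\
  (forall c, c \in clauses phi -> exists2 l, l \in c & l \in a).

Definition interaction (V : finType) (C : {set V}) (I : {set literal V}) : Prop :=
  #|I| = 2 /\ (forall l, l \in I -> l.1 \in C).

Definition feasible (V : finType) (phi : cnf V) (I : {set literal V}) : Prop :=
  exists2 a, configuration phi a & I \subset a.

(* Samples are sequences, so their size counts repetitions: configurations that
   differ only in an eliminated feature coincide after the elimination, and with
   duplicate-free samples a size need not be attainable any more. *)
Definition sample (V : finType) (phi : cnf V) (S : seq {set literal V}) : Prop :=
  forall a, a \in S -> configuration phi a.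

Definition pairwise_coverage (V : finType) (phi : cnf V) (C : {set V})
    (S : seq {set literal V}) : Prop :=
  [/\ forall I, interaction C I -> feasible phi I -> exists2 a, a \in S & I \subset a,
      (exists a, configuration phi a) -> exists a, a \in S
    & forall x, C = [set x] ->
        (exists2 a, configuration phi a & (x, true) \in a) ->
        (exists2 a, configuration phi a & (x, false) \in a) ->
        (exists2 a, a \in S & (x, true) \in a) /\
        (exists2 a, a \in S & (x, false) \in a)].

Definition tautological (V : finType) (c : {set literal V}) : bool :=
  [exists x, ((x, true) \in c) && ((x, false) \in c)].

Definition resolvent (V : finType) (y : V) (c d : {set literal V}) : {set literal V} :=
  (c :\ (y, true)) :|: (d :\ (y, false)).

Definition resolvents (V : finType) (y : V) (G : {set {set literal V}}) :
    {set {set literal V}} :=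
  [set r | [exists c in G, exists d in G,
     [&& (y, true) \in c, (y, false) \in d, r == resolvent y c d
       & ~~ tautological r]]].

Definition eliminate (V : finType) (y : V) (phi : cnf V) : cnf V :=
  Cnf (features phi :\ y)
      [set c in clauses phi :|: resolvents y (clauses phi) |
         ((y, true) \notin c) && ((y, false) \notin c)].

(* Main.v *)
Require Import Defs.
From mathcomp Require Import all_boot.

(** Deleting the literals of [y] turns configurations of the formula into
    configurations of the eliminated one. Conversely, a configuration [b] of
    the eliminated formula extends to [y] or to its negation: otherwise a
    clause falsified by [b] together with [y] and one falsified by [b]
    together with the negation of [y] would have a resolvent falsified by
    [b]. Both maps preserve the literals of concrete features, hence
    coverage. *)

(** A witness of feasibility for [psi] is pulled back along [g], covered in [S], and the covering
    member is pushed forward along [f]. With [f] and [g] arbitrary, both directions of the theorem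
    are instances. *)
Lemma pairwise_coverage_map (V : finType) (phi psi : cnf V) (C : {set V})
    (f g : {set literal V} -> {set literal V}) (S : seq {set literal V}) :
    (forall b, configuration psi b -> configuration phi (g b)) ->
    (forall a l, l.1 \in C -> (l \in f a) = (l \in a)) ->
    (forall b l, l.1 \in C -> (l \in g b) = (l \in b)) ->
  pairwise_coverage phi C S -> pairwise_coverage psi C (map f S).
Proof.
move=> g_conf fC gC [covI cov0 cov1]; split.
- move=> I CI [b b_conf Ib].
  have [|a aS Ia] := covI I CI.
    exists (g b); first exact: g_conf.
    by apply/subsetP=> l Il; rewrite gC ?(subsetP Ib) //; apply: CI.2.
  exists (f a); first exact: map_f.
  by apply/subsetP=> l Il; rewrite fC ?(subsetP Ia) //; apply: CI.2.
- case=> b b_conf; have [|a aS] := cov0; first by exists (g b); apply: g_conf.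
  by exists (f a); apply: map_f.
- move=> x defC [bt bt_conf xbt] [bf bf_conf xbf].
  have xC v : (x, v).1 \in C by rewrite defC set11.
  have [||[at_ atS xat] [af afS xaf]] := cov1 x defC.
  + by exists (g bt); [apply: g_conf | rewrite gC].
  + by exists (g bf); [apply: g_conf | rewrite gC].
  by split; [exists (f at_) | exists (f af)]; rewrite ?map_f ?fC.
Qed.

Definition drop_feature {V : finType} (y : V) (a : {set literal V}) :
    {set literal V} :=
  [set l in a | l.1 != y].

Definition satisfied {V : finType} (phi : cnf V) (a : {set literal V}) : bool :=
  [forall c in clauses phi, [exists l in c, l \in a]].

(** The value of [y] is decided by testing whether true works; otherwise it is false. A function is
    wanted here, since it is mapped over a sample. *)
Definition extend_feature {V : finType} (phi : cnf V) (y : V)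
    (b : {set literal V}) : {set literal V} :=
  (y, satisfied phi ((y, true) |: b)) |: b.

Lemma satisfiedP {V : finType} (phi : cnf V) (a : {set literal V}) :
  reflect (forall c, c \in clauses phi -> exists2 l, l \in c & l \in a)
          (satisfied phi a).
Proof.
by apply: (iffP 'forall_in_exists_inP) => sat c /sat.
Qed.

Lemma in_drop_feature {V : finType} (y : V) (a : {set literal V}) l :
  l.1 != y -> (l \in drop_feature y a) = (l \in a).
Proof. by rewrite inE andbC => ->. Qed.

Lemma in_extend_feature {V : finType} (phi : cnf V) (y : V)
    (b : {set literal V}) l :
  l.1 != y -> (l \in extend_feature phi y b) = (l \in b).
Proof.
by move=> ly; rewrite in_setU1; case: eqP => // El; rewrite El eqxx in ly.
Qed.

Lemma configuration_eliminate_notin {V : finType} {phi : cnf V} {y : V} {b} :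
  configuration (eliminate y phi) b -> forall l, l \in b -> l.1 != y.
Proof. by move=> [[bF _] _] l /bF /=; rewrite in_setD1 => /andP[]. Qed.

(** Yields injectivity of the extension on configurations, hence duplicate-free samples stay
    duplicate-free. *)
Lemma extend_featureK {V : finType} (phi : cnf V) (y : V) b :
  configuration (eliminate y phi) b ->
  drop_feature y (extend_feature phi y b) = b.
Proof.
move=> /configuration_eliminate_notin by_; apply/setP=> l; rewrite inE.
have [ly|ly] := boolP (l.1 == y); last by rewrite andbT in_extend_feature.
by rewrite andbF; apply/esym/negP=> /by_; rewrite ly.
Qed.

Lemma assignment_consistent {V : finType} {F : {set V}} {a} (x : V) :
  assignment F a -> (x, true) \in a -> (x, false) \in a -> False.
Proof. by move=> [aF atot] xa; rewrite -[_ \in a]negbK -atot ?xa // (aF _ xa). Qed.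

Lemma drop_feature_configuration {V : finType} (phi : cnf V) (y : V) a :
  configuration phi a -> configuration (eliminate y phi) (drop_feature y a).
Proof.
move=> [aA sat]; have [aF atot] := aA; split; first split.
- by move=> l; rewrite !inE => /andP[/aF -> ->].
- by move=> x; rewrite in_setD1 => /andP[xy /atot]; rewrite !in_drop_feature.
move=> c; rewrite inE => /andP[cG /andP[ytc yfc]].
have cy l : l \in c -> l.1 != y.
  by case: l => x v lc; apply: contraNneq ytc => /= xy; subst x; case: v lc yfc => // ->.
suff [l lc la] : exists2 l, l \in c & l \in a.
  by exists l; rewrite ?in_drop_feature ?cy.
move: cG; rewrite inE => /orP[/sat //|].
rewrite inE => /exists_inP[d dG /exists_inP[e eG /and4P[_ _ /eqP defc _]]].
have [l ld la] := sat d dG; have [m me ma] := sat e eG.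
(* A literal satisfying [d] other than [y] survives in the resolvent. Otherwise [y] is true in [a],
   so by consistency the literal satisfying [e] is not the negation of [y] and survives. *)
have [lt|lt] := eqVneq l (y, true); last first.
  by exists l => //; rewrite defc !inE lt ld.
exists m => //; rewrite defc !inE me andbT; apply/orP; right.
by apply/eqP=> mf; subst; apply: assignment_consistent aA la ma.
Qed.

(** A falsified clause without the opposite literal of [y] would be free of [y], hence kept by the
    elimination and satisfied by [b]. *)
Lemma falsified_clause {V : finType} {phi : cnf V} {y : V} {b} (v : bool) :
    configuration (eliminate y phi) b -> ~~ satisfied phi ((y, v) |: b) ->
  exists c, [/\ c \in clauses phi, (y, v) \notin c, (y, ~~ v) \in c
              & forall l, l \in c -> l \notin b].
Proof.
move=> [_ sat]; rewrite negb_forall_in => /exists_inP[c cG].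
rewrite negb_exists_in => /forall_inP cF.
have yvc : (y, v) \notin c by apply/negP=> /cF; rewrite !inE eqxx.
have cb l : l \in c -> l \notin b by move=> /cF; rewrite !inE negb_or => /andP[].
exists c; split=> //; apply: contraT => yc.
have [|l /cb lb] := sat c; last by rewrite (negPf lb).
by rewrite !inE cG /=; case: v yvc yc {cF} => /= -> ->.
Qed.

Lemma extend_feature_configuration {V : finType} (phi : cnf V) (y : V) b :
    wf_cnf phi -> y \in features phi ->
    configuration (eliminate y phi) b ->
  configuration phi (extend_feature phi y b).
Proof.
move=> wf yF b_conf; have by_ := configuration_eliminate_notin b_conf.
have [[bF btot] sat] := b_conf; split; first split.
- by move=> l; rewrite in_setU1 => /orP[/eqP -> //|/bF]; rewrite in_setD1 => /andP[].
- move=> x xF; have [->|xy] := eqVneq x y; last first.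
    by rewrite !in_extend_feature // btot // in_setD1 xy.
  have yb v : (y, v) \in b = false by apply/negP=> /by_; rewrite eqxx.
  by rewrite !in_setU1 !yb !orbF !xpair_eqE eqxx; case: satisfied.
apply/satisfiedP; rewrite /extend_feature.
(* If the test succeeds, it is the claim itself; if it fails, [y] is false in the extension. *)
have [//|sat_t] := boolP (satisfied phi ((y, true) |: b)).
apply: contraT => sat_f.
have [c [cG ytc yfc cb]] := falsified_clause true b_conf sat_t.
have [d [dG yfd ytd db]] := falsified_clause false b_conf sat_f.
(* The clause [d], falsified with [y] false, contains [y] positively and so comes first. *)
set r := resolvent y d c.
have rb l : l \in r -> l \notin b.
  by rewrite !inE => /orP[] /andP[_]; [apply: db | apply: cb].
have ytr : (y, true) \notin r by rewrite !inE eqxx (negPf ytc) andbF.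
have yfr : (y, false) \notin r by rewrite !inE eqxx (negPf yfd) andbF.
have rF l : l \in r -> l.1 \in features phi.
  by rewrite !inE => /orP[] /andP[_]; apply: wf.
(* On a feature other than [y], [b] contains one of the two literals, whereas [r] is disjoint from
   [b]. *)
have ntaut : ~~ tautological r.
  apply/existsP=> -[x /andP[xt xf]].
  have xy : x != y by apply: contraTneq xt => ->.
  have := btot x; rewrite in_setD1 xy (rF _ xt) (negPf (rb _ xt)) (rb _ xf).
  by move=> /(_ isT).
(* It remains to see that [r] is a clause of the eliminated formula: [b] would then satisfy it,
   against [rb]. *)
have [|l /rb lb] := sat r; last by rewrite (negPf lb).
rewrite inE ytr yfr !andbT; apply/setUP; right; rewrite inE.
apply/exists_inP; exists d => //; apply/exists_inP; exists c => //.
by rewrite ytd yfc eqxx.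
Qed.

Theorem theoremC2 (V : finType) (phi : cnf V) (C : {set V}) (y : V)
    (wf_phi : wf_cnf phi) (C_sub : C \subset features phi)
    (y_feature : y \in features phi) (y_notC : y \notin C) :
  (forall S : seq {set literal V},
     sample phi S -> pairwise_coverage phi C S ->
     exists T : seq {set literal V},
       [/\ sample (eliminate y phi) T,
           pairwise_coverage (eliminate y phi) C T
         & size T = size S]) /\
  (forall T : seq {set literal V},
     sample (eliminate y phi) T -> pairwise_coverage (eliminate y phi) C T ->
     exists S : seq {set literal V},
       [/\ sample phi S,
           pairwise_coverage phi C S,
           size S = size T
         & uniq T -> uniq S]).
Proof.
have Cy (l : literal V) : l.1 \in C -> l.1 != y by apply: contraTneq => ->.
have dropC a l : l.1 \in C -> (l \in drop_feature y a) = (l \in a).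
  by move=> /Cy; apply: in_drop_feature.
have extC b l : l.1 \in C -> (l \in extend_feature phi y b) = (l \in b).
  by move=> /Cy; apply: in_extend_feature.
have ext_conf b := @extend_feature_configuration V phi y b wf_phi y_feature.
split=> [S S_sample S_cov | T T_sample T_cov].
  exists (map (drop_feature y) S); split; last by rewrite size_map.
  - by move=> _ /mapP[a /S_sample a_conf ->]; apply: drop_feature_configuration.
  - exact: pairwise_coverage_map ext_conf dropC extC S_cov.
exists (map (extend_feature phi y) T); split; last 2 first.
- by rewrite size_map.
- rewrite map_inj_in_uniq // => b b' /T_sample b_conf /T_sample b'_conf eq_ext.
  by rewrite -(extend_featureK phi y b b_conf) eq_ext extend_featureK.
- by move=> _ /mapP[b /T_sample b_conf ->]; apply: ext_conf.
- apply: pairwise_coverage_map extC dropC T_cov.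
  exact: drop_feature_configuration.
Qed.
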